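(* Let $(X,\mathcal A)$ be a measurable space, let $k:X\times X\to\mathbb R$ be a measurable kernel with reproducing kernel Hilbert space $H$ with norm $\|\cdot\|_H$, and let $\Phi:\mathcal M_1^k(X)\to H$ be the kernel embedding $$\Phi(P):=\int k(\cdot,\omega)\,\mathrm dP(\omega).$$ Then the kernel score $S_k$ satisfies $$\|\Phi(P)-\Phi(Q)\|_H^2=2\left(\int S_k(Q,x)\,\mathrm dP(x)-\int S_k(P,x)\,\mathrm dP(x)\right)$$ for all $P,Q\in\mathcal M_1^k(X)$. In particular, $S_k$ is a proper scoring rule with respect to $\mathcal M_1^k(X)$, and it is strictly proper with respect to $\mathcal M_1^k(X)$ if and only if $\Phi$ is injective.
   Context: A kernel on $X$ is a symmetric function $k:X\times X\to\mathbb R$ that is positive definite, i.e. $\sum_{i,j=1}^n a_ia_jk(x_i,x_j)\ge 0$ for all $n$, all $a_1,\dots,a_n\in\mathbb R$ and all $x_1,\dots,x_n\in X$. $\mathcal M_1(X)$ is the set of all probability measures on $(X,\mathcal A)$, and $\mathcal M_1^k(X):=\{P\in\mathcal M_1(X): \int_X\sqrt{k(x,x)}\,\mathrm dP(x)<\infty\}$. The integral defining $\Phi(P)$ is a Pettis integral in $H$: $\Phi(P)$ is the unique element of $H$ with $\langle h,\Phi(P)\rangle_H=\int h\,\mathrm dP$ for all $h\in H$. For $\mathcal P\subseteq\mathcal M_1(X)$, a scoring rule is a function $S:\mathcal P\times X\to[-\infty,\infty]$ such that $\int S(P,x)\,\mathrm dQ(x)$ exists for all $P,Q\in\mathcal P$.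 It is proper with respect to $\mathcal P$ if $\int S(P,x)\,\mathrm dP(x)\le\int S(Q,x)\,\mathrm dP(x)$ for all $P,Q\in\mathcal P$, and strictly proper if moreover equality in this inequality implies $P=Q$. The kernel score associated with a measurable kernel $k$ is $S_k:\mathcal M_1^k(X)\times X\to\mathbb R$, $$S_k(P,x):=-\int k(\omega,x)\,\mathrm dP(\omega)+\frac12\int\int k(\omega,\omega')\,\mathrm dP(\omega)\,\mathrm dP(\omega').$$ *)

(* Defs.v *)
From HB Require Import structures.
From mathcomp Require Import all_boot all_order all_algebra.
From mathcomp Require Import all_classical all_reals all_analysis.
From mathcomp Require Import measurable_realfun.

Set Implicit Arguments.
Unset Strict Implicit.
Unset Printing Implicit Defensive.

Import Order.TTheory GRing.Theory Num.Theory.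
Import numFieldNormedType.Exports.

Local Open Scope classical_set_scope.
Local Open Scope ring_scope.

Section Kernels.
Context {R : realType} {X : Type}.
Implicit Type k : X -> X -> R.

Definition is_kernel k : Prop :=
  (forall x y, k x y = k y x) /\
  (forall (n : nat) (a : 'I_n -> R) (x : 'I_n -> X),
     0 <= \sum_(i < n) \sum_(j < n) a i * a j * k (x i) (x j)).

(* A Hilbert space is a complete normed space whose norm is induced by a
   symmetric, bilinear, positive definite form. The elements of an RKHS are
   functions on X: here the linear injection rkhs_fun identifies the carrier
   with a vector space of functions. *)
Record rkhs k := Rkhs {
  rkhs_car :> completeNormedModType R ;
  rkhs_dot : {dot rkhs_car for idfun} ;
  rkhs_norm : forall h : rkhs_car, `|h| ^+ 2 = rkhs_dot h h ;
  rkhs_fun : rkhs_car -> X -> R ;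
  rkhs_fun_linear : forall (a : R) (f g : rkhs_car) (x : X),
    rkhs_fun (a *: f + g) x = a * rkhs_fun f x + rkhs_fun g x ;
  rkhs_fun_inj : injective rkhs_fun ;
  rkhs_section : X -> rkhs_car ;
  rkhs_sectionE : forall x y : X, rkhs_fun (rkhs_section x) y = k y x ;
  rkhs_reproducing : forall (f : rkhs_car) (x : X),
    rkhs_fun f x = rkhs_dot f (rkhs_section x)
}.

End Kernels.

Section Scores.
Context {R : realType} {d : measure_display} {X : measurableType d}.
Implicit Types (P Q : probability X R) (k : X -> X -> R).

(* The library's measures are functions on all subsets of X, with unconstrained
   values outside the sigma-algebra, so Leibniz equality would be too fine. *)
Definition same_law P Q : Prop :=
  forall A : set X, measurable A -> P A = Q A.

Definition M1k k : set (probability X R) :=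
  [set P | (\int[P]_x (Num.sqrt (k x x))%:E < +oo)%E].

Definition integral_exists P (f : X -> \bar R) : Prop :=
  measurable_fun setT f /\
  ((\int[P]_x (f^\+ x) < +oo)%E \/ (\int[P]_x (f^\- x) < +oo)%E).

(* Only the values S P x with P \in M are relevant in the next three
   definitions. *)
Definition scoring_rule (M : set (probability X R))
    (S : probability X R -> X -> \bar R) : Prop :=
  forall P Q, M P -> M Q -> integral_exists Q (S P).

Definition proper_scoring_rule (M : set (probability X R))
    (S : probability X R -> X -> \bar R) : Prop :=
  scoring_rule M S /\
  (forall P Q, M P -> M Q -> (\int[P]_x S P x <= \int[P]_x S Q x)%E).

Definition strictly_proper_scoring_rule (M : set (probability X R))
    (S : probability X R -> X -> \bar R) : Prop :=
  proper_scoring_rule M S /\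
  (forall P Q, M P -> M Q ->
     (\int[P]_x S P x = \int[P]_x S Q x)%E -> same_law P Q).

(* For P in M1k, |k w x| <= sqrt (k w w) * sqrt (k x x) makes all the integrals
   below absolutely convergent. *)
Definition kernel_score k P (x : X) : R :=
  - (\int[P]_w k w x) + 2^-1 * \int[P]_w \int[P]_w' k w w'.

Definition is_kernel_mean k (H : rkhs k) P (g : H) : Prop :=
  forall h : H,
    P.-integrable setT (fun x => (rkhs_fun h x)%:E) /\
    ((rkhs_dot H h g)%:E = \int[P]_x (rkhs_fun h x)%:E)%E.

(* The Pettis integral of w |-> k(., w) with respect to P; such a g is unique
   because the inner product is definite. *)
Definition kernel_embedding k (H : rkhs k) P : H :=
  xget (0 : H) [set g : H | is_kernel_mean P g].

End Scores.

(* Main.v *)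
(* By the Riesz representation theorem the mean Phi(P) exists, with
   Phi(P)(x) = \int k(w, x) dP(w) and
   \int \int k(w, w') dP dP = |Phi(P)|^2. Hence
   S_k(P, x) = - Phi(P)(x) + |Phi(P)|^2 / 2, whose Q-integral is
   - <Phi(P), Phi(Q)> + |Phi(P)|^2 / 2, and expanding |Phi(P) - Phi(Q)|^2
   gives the identity. *)
Require Import Defs.
From HB Require Import structures.
From mathcomp Require Import all_boot all_order all_algebra.
From mathcomp Require Import all_classical all_reals all_analysis.
From mathcomp Require Import measurable_realfun.
From mathcomp Require Import ring lra.

Set Implicit Arguments.
Unset Strict Implicit.
Unset Printing Implicit Defensive.

Import Order.TTheory GRing.Theory Num.Theory.
Import numFieldNormedType.Exports.

Local Open Scope classical_set_scope.
Local Open Scope ring_scope.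

(** The discriminant criterion, with the degenerate case [q = 0] included: an affine function of [t]
    that is bounded below is constant, so [c = 0]. *)
Lemma sqr_le_of_quadratic_ge0 (R : realFieldType) (e c q : R) :
  0 <= q -> (forall t, 0 <= e + 2 * t * c + t ^+ 2 * q) -> c ^+ 2 <= e * q.
Proof.
rewrite le_eqVlt => /predU1P[<-|q0] h.
  have [->|c0] := eqVneq c 0; first by rewrite expr0n mulr0.
  (* This [t] gives the affine function [e + 2 * t * c] the value [-1]. *)
  have := h (- (e + 1) / (2 * c)).
  have -> : e + 2 * (- (e + 1) / (2 * c)) * c +
    (- (e + 1) / (2 * c)) ^+ 2 * 0 = -1 by field.
  by rewrite oppr_ge0 ler10.
(* For [q > 0] the quadratic is tested at its minimizer. *)
have := h (- c / q).
have -> : e + 2 * (- c / q) * c + (- c / q) ^+ 2 * q = (e * q - c ^+ 2) / q.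
  by field; rewrite gt_eqF.
by rewrite pmulr_lge0 ?invr_gt0// subr_ge0.
Qed.

(** * Hilbert spaces: Cauchy-Schwarz and Riesz representation *)

Section hilbert.
Context {R : realType} {V : completeNormedModType R}.
Variable dot : {dot V for idfun}.
Hypothesis normE : forall h : V, `|h| ^+ 2 = dot h h.

Lemma dotC u v : dot u v = dot v u.
Proof. by rewrite (hermC dot) expr0 mul1r. Qed.

Lemma dotDl u v w : dot (u + v) w = dot u w + dot v w.
Proof. exact: linearDl. Qed.

Lemma dotDr u v w : dot w (u + v) = dot w u + dot w v.
Proof. exact: linearDr. Qed.

Lemma dotZl a u w : dot (a *: u) w = a * dot u w.
Proof. exact: linearZl_LR. Qed.

Lemma dotZr a u w : dot w (a *: u) = a * dot w u.
Proof. by rewrite dotC dotZl dotC. Qed.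

Lemma dotBl u v w : dot (u - v) w = dot u w - dot v w.
Proof. exact: linearBl. Qed.

Lemma dot_norm_sub u v :
  `|u - v| ^+ 2 = `|u| ^+ 2 - 2 * dot u v + `|v| ^+ 2.
Proof.
rewrite !normE dotBl !(dotC _ (u - v)) !dotBl (dotC v u).
ring.
Qed.

Lemma dot_cauchy_schwarz u v : `|dot u v| <= `|u| * `|v|.
Proof.
rewrite -(@ler_pXn2r _ 2) ?nnegrE ?mulr_ge0// real_normK ?num_real//.
rewrite exprMn; apply: sqr_le_of_quadratic_ge0 => [|t]; first exact: sqr_ge0.
suff -> : `|u| ^+ 2 + 2 * t * dot u v + t ^+ 2 * `|v| ^+ 2 =
  `|u + t *: v| ^+ 2 by exact: sqr_ge0.
rewrite !normE dotDl !dotDr !dotZl !dotZr (dotC v u).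
ring.
Qed.

Lemma dot_cvgl (u : nat -> V) (l h : V) :
  u @ \oo --> l -> (fun n => dot (u n) h) @ \oo --> dot l h.
Proof.
move=> ul; apply/cvgrPdistC_le => e e0.
(* The summand [1] keeps the denominator positive when [h = 0]. *)
have d0 : 0 < e / (`|h| + 1) by rewrite divr_gt0// ltr_wpDl.
move/cvgrPdistC_le : ul => /(_ _ d0); apply: filterS => n un.
rewrite -dotBl (le_trans (dot_cauchy_schwarz _ _))//.
apply: (@le_trans _ _ (e / (`|h| + 1) * `|h|)); first exact: ler_wpM2r.
by rewrite mulrAC ler_pdivrMr ?ltr_wpDl// ler_pM2l// lerDl.
Qed.

(* The representing vector is the limit of a minimizing sequence of the
   functional h |-> |h|^2 - 2 L h on W. *)
Lemma riesz_closed_subspace (W : set V) (L : V -> R) (C : R) :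
  W 0 ->
  (forall a f g, W f -> W g -> W (a *: f + g)) ->
  (forall (u : nat -> V) l, (forall n, W (u n)) -> u @ \oo --> l -> W l) ->
  (forall a f g, W f -> W g -> L (a *: f + g) = a * L f + L g) ->
  (forall f, W f -> `|L f| <= C * `|f|) ->
  exists2 g, W g & forall h, W h -> L h = dot g h.
Proof.
move=> W0 Wlin Wcl Llin Lb.
pose J h : R := `|h| ^+ 2 - 2 * L h.
pose m := inf (J @` W).
have J_lb : has_lbound (J @` W).
  (* Completing the square: [J h >= |h|^2 - 2 C |h| = (|h| - C)^2 - C^2]. *)
  exists (- C ^+ 2) => _ [h Wh <-].
  have := Lb _ Wh; rewrite ler_norml => /andP[_ LC].
  have := sqr_ge0 (`|h| - C); rewrite /J; nra.
have J_ge h : W h -> m <= J h by move=> Wh; apply: ge_inf => //; exists h.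
pose e n : R := n.+1%:R^-1.
have e0 n : 0 < e n by rewrite invr_gt0.
have [u Wu Ju] : exists2 u : nat -> V,
    forall n, W (u n) & forall n, J (u n) < m + e n.
  have ex n : exists h, W h /\ J h < m + e n.
    have [||_ [h Wh <-] Jh] := @inf_adherent _ (J @` W) (e n); last by exists h.
      exact: e0.
    by split => //; exists (J 0), 0.
  by have [u Pu] := choice ex; exists u => n; have [] := Pu n.
(* The parallelogram law gives [|f - g|^2 = 2 J f + 2 J g - 4 J ((f + g) / 2)], and the midpoint
   lies in [W], so [J] is at least [m] there. *)
have parallelogram f g : W f -> W g ->
    `|f - g| ^+ 2 <= 2 * (J f - m) + 2 * (J g - m).
  move=> Wf Wg.
  have Wg2 : W (2^-1 *: g) by rewrite -[_ *: _]addr0; apply: Wlin.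
  have L0 : L 0 = 0.
    by have := Llin (-1) 0 0 W0 W0; rewrite scaler0 addr0; lra.
  have Lg2 : L (2^-1 *: g) = 2^-1 * L g.
    by have := Llin 2^-1 g 0 Wg W0; rewrite !addr0 L0 addr0.
  have := J_ge _ (Wlin 2^-1 _ _ Wf Wg2).
  rewrite /J dot_norm_sub Llin// Lg2.
  rewrite !normE dotDl !dotDr !dotZl !dotZr (dotC g f).
  lra.
have u_cauchy (eps : R) : 0 < eps ->
    exists N, forall i j, (N <= i)%N -> (N <= j)%N -> `|u i - u j| < eps.
  (* Beyond [N], [|u i - u j|^2 <= 2 e i + 2 e j < 4 (eps^2 / 4)]. *)
  move=> eps0; have d0 : 0 < eps ^+ 2 / 4 by rewrite divr_gt0// exprn_gt0.
  have /cvgr0Pnorm_lt/(_ _ d0)[N _ HN] := @cvg_harmonic R.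
  exists N => i j Ni Nj.
  rewrite -(@ltr_pXn2r _ 2) ?nnegrE ?(ltW eps0)//.
  apply: (le_lt_trans (parallelogram _ _ (Wu i) (Wu j))).
  have He n : (N <= n)%N -> e n < eps ^+ 2 / 4.
    by move=> /HN; rewrite /= gtr0_norm ?e0.
  have := Ju i; have := Ju j; have := He _ Ni; have := He _ Nj.
  move: (J (u i)) (J (u j)) (e i) (e j) (eps ^+ 2) => a b a' b' c.
  lra.
have : cvgn u.
  apply/cauchy_cvgP/cauchy_ballP => eps /u_cauchy[N HN]; near_simpl.
  exists ([set n | N <= n]%N, [set n | N <= n]%N).
    by split; exists N.
  by move=> [i j] [/= Ni Nj]; rewrite -ball_normE; exact: HN.
move=> /cvg_ex[g ug]; exists g => [|h Wh]; first exact: Wcl ug.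
(* An approximate first-order condition: [J (u n + t h) >= m > J (u n) - e n] for all [t] says that
   a quadratic in [t] is nonnegative, with [dot (u n) h - L h] as half its linear coefficient. In
   the limit this coefficient vanishes. *)
have bnd n : (dot (u n) h - L h) ^+ 2 <= e n * `|h| ^+ 2.
  apply: sqr_le_of_quadratic_ge0 => [|t]; first exact: sqr_ge0.
  have := J_ge _ (Wlin t _ _ Wh (Wu n)); have := Ju n.
  rewrite /J Llin// !normE dotDl !dotDr !dotZl !dotZr (dotC h).
  lra.
have lim0 : e n * `|h| ^+ 2 @[n --> \oo] --> 0 * `|h| ^+ 2.
  by apply: cvgMl; exact: cvg_harmonic.
have limd : (dot (u n) h - L h) ^+ 2 @[n --> \oo] --> (dot g h - L h) ^+ 2.
  by under eq_fun do rewrite expr2; rewrite expr2;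
    apply: cvgM; (apply: cvgB; [exact: dot_cvgl|exact: cvg_cst]).
have : (dot g h - L h) ^+ 2 <= 0 * `|h| ^+ 2.
  by apply: (ler_cvg_to limd lim0); near=> n; exact: bnd.
rewrite mul0r => h0; apply/esym/eqP; rewrite -subr_eq0 -sqrf_eq0.
by rewrite eq_le h0 sqr_ge0.
Unshelve. all: by end_near. Qed.

End hilbert.

(** * Measurability of the functions of an RKHS *)

Section rkhs_measurable.
Context {R : realType} {d : measure_display} {X : measurableType d}.
Variables (k : X -> X -> R) (H : rkhs k).
Hypothesis k_meas : measurable_fun [set: X * X] (fun p : X * X => k p.1 p.2).

Let dot := rkhs_dot H.
Let sec := @rkhs_section _ _ _ H.

Lemma rkhs_dot_section x y : dot (sec x) (sec y) = k y x.
Proof. by rewrite -rkhs_reproducing rkhs_sectionE. Qed.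

Lemma rkhs_kernel_sym x y : k x y = k y x.
Proof. by rewrite -!rkhs_dot_section dotC. Qed.

(** Cauchy-Schwarz in the reproducing property, as [|k(., x)|^2 = k x x]. Through this bound,
    membership in [M1k] yields the integrability of every function of [H]. *)
Lemma rkhs_fun_bound (h : H) x : `|rkhs_fun h x| <= `|h| * Num.sqrt (k x x).
Proof.
rewrite rkhs_reproducing -rkhs_dot_section /dot -rkhs_norm sqrtr_sqr normr_id.
exact/dot_cauchy_schwarz/rkhs_norm.
Qed.

Lemma measurable_diag : measurable_fun setT (fun x => k x x).
Proof.
apply: (measurableT_comp k_meas (g := fun x => (x, x))).
exact: measurable_fun_pair.
Qed.

(* The functions of H that are measurable form a closed subspace W containing
   all sections k(., y). The vector of W representing h |-> <f, h> on W takes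
   the same values as f, since it is tested against the sections only. *)
Lemma measurable_rkhs_fun (f : H) : measurable_fun setT (rkhs_fun f).
Proof.
pose W : set H := [set h | measurable_fun setT (rkhs_fun h)].
have Wsec y : W (sec y).
  rewrite /W /= (_ : rkhs_fun _ = k ^~ y); last first.
    by apply/funext => x; rewrite rkhs_sectionE.
  exact: (measurableT_comp k_meas (pair2_measurable y)).
have W0 : W 0.
  rewrite /W /= (_ : rkhs_fun _ = cst 0); last first.
    by apply/funext => x; rewrite rkhs_reproducing linear0l.
  exact: measurable_cst.
have [||||g Wg gE] := @riesz_closed_subspace _ _ _ (@rkhs_norm _ _ _ H) W
    (dot f) `|f| W0.
- move=> a u v Wu Wv.
  rewrite /W /= (_ : rkhs_fun _ = fun x => a * rkhs_fun u x + rkhs_fun v x); last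
     by apply/funext => x; rewrite rkhs_fun_linear.
  by apply: measurable_funD => //; apply: measurable_funM.
(* [W] is closed: by the reproducing property, convergence in [H] implies pointwise convergence,
   which preserves measurability. *)
- move=> u l Wu ul; rewrite /W /=; apply/measurable_EFinP.
  apply: (@emeasurable_fun_cvg _ _ _ _ (fun n x => (rkhs_fun (u n) x)%:E)).
    by move=> n; apply/measurable_EFinP; exact: Wu.
  move=> x _; apply: cvg_EFin; first exact: nearW.
  rewrite /comp/=; under eq_fun do rewrite rkhs_reproducing.
  by rewrite rkhs_reproducing; apply: dot_cvgl => //; exact: rkhs_norm.
- by move=> a u v _ _; rewrite dotDr dotZr.
- by move=> h _; apply: dot_cauchy_schwarz; exact: rkhs_norm.
suff -> : rkhs_fun f = rkhs_fun g by [].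
by apply/funext => x; rewrite !rkhs_reproducing -gE.
Qed.

(** * Kernel embedding and score of one measure *)

Section embedding.
Variables (P : probability X R).
Hypothesis kP : M1k k P.

Lemma integrable_sqrt_diag :
  P.-integrable setT (fun x => (Num.sqrt (k x x))%:E).
Proof.
apply/integrableP; split.
  apply/measurable_EFinP; apply: measurableT_comp measurable_diag.
  by apply: continuous_measurable_fun; exact: sqrt_continuous.
by under eq_integral do rewrite gee0_abs ?lee_fin ?sqrtr_ge0//.
Qed.

Lemma integrable_rkhs_fun (h : H) :
  P.-integrable setT (fun x => (rkhs_fun h x)%:E).
Proof.
apply: (@le_integrable _ _ _ _ _ _ _
    (fun x => `|h|%:E * (Num.sqrt (k x x))%:E)%E) => //.
- by apply/measurable_EFinP; exact: measurable_rkhs_fun.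
- move=> x _; rewrite -EFinM lee_fin [leRHS]ger0_norm; first exact: rkhs_fun_bound.
  by rewrite mulr_ge0// sqrtr_ge0.
- exact/integrableZl/integrable_sqrt_diag.
Qed.

(** Integration against [P] is a linear functional on [H], bounded with constant
    [\int sqrt (k x x) dP]; Riesz representation is applied with the whole space as [W]. *)
Lemma kernel_mean_exists : exists g : H, is_kernel_mean P g.
Proof.
pose L (h : H) := \int[P]_x rkhs_fun h x.
have LE h : (\int[P]_x (rkhs_fun h x)%:E = (L h)%:E)%E.
  rewrite /L /Rintegral fineK//.
  by apply: integrable_fin_num => //; exact: integrable_rkhs_fun.
have [|||||g _ gE] := @riesz_closed_subspace _ _ _ (@rkhs_norm _ _ _ H) setT L
    (\int[P]_x Num.sqrt (k x x)) => //.
- move=> a u v _ _; rewrite /L.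
  under eq_Rintegral do rewrite rkhs_fun_linear.
  rewrite RintegralD ?RintegralZl//; try exact: integrable_rkhs_fun.
  by rewrite /comp/=; under eq_fun do rewrite EFinM;
    exact/integrableZl/integrable_rkhs_fun.
- move=> h _; rewrite /L.
  apply: (le_trans (le_normr_Rintegral _ _)) => //.
    exact: integrable_rkhs_fun.
  rewrite mulrC -RintegralZl//; last exact: integrable_sqrt_diag.
  apply: le_Rintegral => //.
  + exact/integrable_norm/integrable_rkhs_fun.
  + by rewrite /comp/=; under eq_fun do rewrite EFinM;
      exact/integrableZl/integrable_sqrt_diag.
  + by move=> x _; exact: rkhs_fun_bound.
exists g => h; split; first exact: integrable_rkhs_fun.
by rewrite LE gE// dotC.
Qed.

(** Since a mean exists, [xget] does not fall back on its default [0]. *)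
Lemma kernel_embeddingP : is_kernel_mean P (kernel_embedding H P).
Proof. exact: (xgetPex 0 kernel_mean_exists). Qed.

Lemma Rintegral_rkhs_fun (h : H) :
  \int[P]_x rkhs_fun h x = dot h (kernel_embedding H P).
Proof. by rewrite /Rintegral -(kernel_embeddingP h).2. Qed.

Lemma kernel_scoreE x :
  kernel_score k P x = - rkhs_fun (kernel_embedding H P) x +
    2^-1 * `|kernel_embedding H P| ^+ 2.
Proof.
have int_k w : \int[P]_w' k w' w = rkhs_fun (kernel_embedding H P) w.
  under eq_Rintegral do rewrite -(@rkhs_sectionE _ _ _ H).
  by rewrite Rintegral_rkhs_fun rkhs_reproducing dotC.
rewrite /kernel_score int_k; congr (_ + _ * _).
(* The inner integral runs over the second argument of [k], whereas [int_k] integrates over the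
   first; symmetry exchanges them. The outer integral then pairs the embedding with itself. *)
under eq_Rintegral => w _.
  under eq_Rintegral do rewrite rkhs_kernel_sym.
  rewrite int_k; over.
by rewrite Rintegral_rkhs_fun -rkhs_norm.
Qed.

End embedding.

(** * Expected scores and propriety *)

Lemma integrable_kernel_score (P Q : probability X R) : M1k k P -> M1k k Q ->
  Q.-integrable setT (fun x => (kernel_score k P x)%:E).
Proof.
move=> kP kQ; under eq_fun do rewrite kernel_scoreE// EFinD EFinN.
apply: integrableD => //; first exact/integrableN/integrable_rkhs_fun.
exact: finite_measure_integrable_cst.
Qed.

Lemma integral_kernel_score (P Q : probability X R) : M1k k P -> M1k k Q ->
  (\int[Q]_x (kernel_score k P x)%:E =
   (- dot (kernel_embedding H P) (kernel_embedding H Q) +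
     2^-1 * `|kernel_embedding H P| ^+ 2)%:E)%E.
Proof.
move=> kP kQ; under eq_integral do rewrite kernel_scoreE// EFinD EFinN.
rewrite integralD//; last 2 first.
- exact/integrableN/integrable_rkhs_fun.
- exact: finite_measure_integrable_cst.
rewrite integralN; last exact/integrable_add_def/(integrable_rkhs_fun kQ).
rewrite -((kernel_embeddingP kQ _).2) integral_cst//.
by rewrite [X in (_ * X)%E]probability_setT mule1.
Qed.

Lemma kernel_embedding_dist (P Q : probability X R) : M1k k P -> M1k k Q ->
  ((`|kernel_embedding H P - kernel_embedding H Q| ^+ 2)%:E =
   2%:E * (\int[P]_x (kernel_score k Q x)%:E
           - \int[P]_x (kernel_score k P x)%:E))%E.
Proof.
move=> kP kQ; rewrite !integral_kernel_score// -EFinB -EFinM; congr EFin.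
rewrite (dot_norm_sub (@rkhs_norm _ _ _ H)) -rkhs_norm dotC.
rewrite (_ : rkhs_dot H = dot)//; lra.
Qed.

Lemma kernel_score_proper :
  proper_scoring_rule (M1k k) (fun P x => (kernel_score k P x)%:E).
Proof.
split=> P Q kP kQ.
  have iS := integrable_kernel_score kP kQ.
  split; first exact: measurable_int iS.
  by left; rewrite ltey_eq integrable_pos_fin_num.
have := kernel_embedding_dist kP kQ.
rewrite !integral_kernel_score// -EFinB -EFinM => -[dE].
rewrite lee_fin -subr_ge0 -(@pmulr_rge0 _ 2)// -dE.
exact: sqr_ge0.
Qed.

(** Both sides say that the squared distance in [kernel_embedding_dist] vanishes. Strict propriety
    and injectivity thus become the same implication towards [same_law]. *)
Lemma eq_kernel_embedding (P Q : probability X R) : M1k k P -> M1k k Q ->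
  kernel_embedding H P = kernel_embedding H Q <->
  (\int[P]_x (kernel_score k P x)%:E = \int[P]_x (kernel_score k Q x)%:E)%E.
Proof.
move=> kP kQ; have := kernel_embedding_dist kP kQ.
rewrite !integral_kernel_score// -EFinB -EFinM => -[dE]; split=> [->//|[eqS]].
by apply/eqP; rewrite -subr_eq0 -normr_eq0 -sqrf_eq0 dE eqS subrr mulr0.
Qed.

End rkhs_measurable.

Theorem theorem1p1 (R : realType) (d : measure_display) (X : measurableType d)
  (k : X -> X -> R) (k_kernel : is_kernel k)
  (k_meas : measurable_fun [set: X * X] (fun p : X * X => k p.1 p.2))
  (H : rkhs k) :
  [/\ forall P Q : probability X R, M1k k P -> M1k k Q ->
        ((`|kernel_embedding H P - kernel_embedding H Q| ^+ 2)%:E =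
         2%:E * (\int[P]_x (kernel_score k Q x)%:E
                 - \int[P]_x (kernel_score k P x)%:E))%E,
      proper_scoring_rule (M1k k) (fun P x => (kernel_score k P x)%:E) &
      strictly_proper_scoring_rule (M1k k)
        (fun P x => (kernel_score k P x)%:E) <->
      (forall P Q : probability X R, M1k k P -> M1k k Q ->
         kernel_embedding H P = kernel_embedding H Q -> same_law P Q)].
Proof.
split; [exact: kernel_embedding_dist|exact: (kernel_score_proper H k_meas)|].
split=> [[_ strict] P Q kP kQ /(eq_kernel_embedding H k_meas kP kQ)|inj].
  exact: strict.
split=> [|P Q kP kQ /(eq_kernel_embedding H k_meas kP kQ)]; last exact: inj.
exact: (kernel_score_proper H k_meas).
Qed.
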